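(* Let $\mathcal{X}$ and $\mathcal{Z}$ be Euclidean spaces. Let $\mathfrak{S}:\mathcal{X}\to\mathcal{Z}$ be a differentiable mapping such that $\mathfrak{S}$ and its G\^ateaux derivative $\mathrm{D}\mathfrak{S}$ are Lipschitz continuous; let $g:\mathcal{Z}\to\mathbb{R}$ be Lipschitz continuous and $\eta$-weakly convex for some $\eta>0$; let $C\subset\mathcal{X}$ be a nonempty closed prox-regular set; set $F:=g\circ\mathfrak{S}$ and assume $\mathop{\mathrm{argmin}}_{x\in C}F(x)\neq\emptyset$. Let $(x_n)_{n\ge1}\subset C$ converge to some $\bar x\in C$ and let $(\gamma_n)_{n\ge1}\subset(0,\infty)$ converge to some $\bar\gamma\ge 0$. Let $(\mu_n)_{n\ge1}\subset(0,(2\eta)^{-1}]$ decrease to $0$ and set $F_n:={}^{\mu_n}g\circ\mathfrak{S}$ for $n\in\mathbb{N}$. Then $$\liminf_{n\to\infty}\mathcal{M}_{\gamma_n}^{F_n,\iota_C}(x_n)\ \ge\ \begin{cases}\mathcal{M}_{\bar\gamma}^{F,\iota_C}(\bar x), & \text{if } \bar\gamma>0,\\ \mathrm{dist}\big(0,\partial_F(F+\iota_C)(\bar x)\big), & \text{if } \bar\gamma=0.\end{cases}$$ Moreover, if $\liminf_{n\to\infty}\mathcal{M}_{\gamma_n}^{F_n,\iota_C}(x_n)=0$, then $\bar x$ satisfies $0\in\partial_F(F+\iota_C)(\bar x)$.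
   Context: Prox-regularity of $C$: the metric projection $P_C(\bar x):=\mathop{\mathrm{argmin}}_{x\in C}\|\bar x-x\|$ is single-valued on some open subset of $\mathcal{X}$ containing $C$. $\iota_C$ is the indicator function of $C$ ($0$ on $C$, $+\infty$ elsewhere). For a proper $J:\mathcal{X}\to\mathbb{R}\cup\{+\infty\}$, the Fr\'echet subdifferential $\partial_F J(\bar x)$ at $\bar x\in\mathrm{dom}\,J$ is the set of $v$ with $\sup_{\epsilon>0}\inf_{0<\|x-\bar x\|<\epsilon}\frac{J(x)-J(\bar x)-\langle v,x-\bar x\rangle}{\|x-\bar x\|}\ge0$ (empty if $\bar x\notin\mathrm{dom}\,J$); for differentiable $J$ with continuous gradient it is $\{\nabla J(\bar x)\}$. For $\mu\in(0,\eta^{-1})$, the proximity operator $\mathrm{prox}_{\mu g}(\bar z):=\mathop{\mathrm{argmin}}_{z\in\mathcal{Z}}\big(g(z)+\frac{1}{2\mu}\|z-\bar z\|^2\big)$ is single-valued, and the Moreau envelope is ${}^{\mu}g(\bar z):=g(\mathrm{prox}_{\mu g}(\bar z))+\frac{1}{2\mu}\|\mathrm{prox}_{\mu g}(\bar z)-\bar z\|^2$, which is continuously differentiable. For a function $J:\mathcal{X}\to\mathbb{R}$, $\gamma>0$ and $\bar x\in\mathcal{X}$, $\mathcal{M}_{\gamma}^{J,\iota_C}(\bar x):=\mathrm{dist}\big(0,\{(\bar x-p)/\gamma : p\in P_C(\bar x-\gamma v),\ v\in\partial_F J(\bar x)\}\big)$, with $\mathrm{dist}(0,S)=\inf_{s\in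 S}\|s\|$. *)

(* Defs.v *)
From HB Require Import structures.
From mathcomp Require Import all_boot all_order all_algebra.
From mathcomp Require Import all_classical all_reals all_analysis.
Set Implicit Arguments. Unset Strict Implicit. Unset Printing Implicit Defensive.
Import Order.TTheory GRing.Theory Num.Theory.
Import numFieldNormedType.Exports.
Local Open Scope classical_set_scope.
Local Open Scope ring_scope.

Section Defs.
Variable R : realType.

Definition dot {n : nat} (u v : 'rV[R]_n) : R := \sum_(i < n) u ord0 i * v ord0 i.
Definition enorm {n : nat} (u : 'rV[R]_n) : R := Num.sqrt (dot u u).

Definition lipschitz {n m : nat} (f : 'rV[R]_n -> 'rV[R]_m) : Prop :=
  exists L : R, forall x y, enorm (f x - f y) <= L * enorm (x - y).

Definition lipschitz_real {n : nat} (f : 'rV[R]_n -> R) : Prop :=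
  exists L : R, forall x y, `|f x - f y| <= L * enorm (x - y).

(* Lipschitz continuity of the derivative x |-> DS(x) (operator norm). *)
Definition lipschitz_deriv {n m : nat} (S : 'rV[R]_n -> 'rV[R]_m) : Prop :=
  exists L : R, forall x y v,
    enorm ('d S x v - 'd S y v) <= L * enorm (x - y) * enorm v.

Definition weakly_convex {m : nat} (eta : R) (g : 'rV[R]_m -> R) : Prop :=
  forall (x y : 'rV[R]_m) (t : R), 0 <= t <= 1 ->
    g (t *: x + (1 - t) *: y) + eta / 2 * enorm (t *: x + (1 - t) *: y) ^+ 2
    <= t * (g x + eta / 2 * enorm x ^+ 2) + (1 - t) * (g y + eta / 2 * enorm y ^+ 2).

Definition proj {n : nat} (C : set 'rV[R]_n) (x : 'rV[R]_n) : set 'rV[R]_n :=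
  [set p | C p /\ forall q, C q -> enorm (x - p) <= enorm (x - q)].

Definition prox_regular {n : nat} (C : set 'rV[R]_n) : Prop :=
  exists U : set 'rV[R]_n, open U /\ C `<=` U /\
    forall x, U x -> exists p, proj C x = [set p].

Definition indicator_fun {n : nat} (C : set 'rV[R]_n) (x : 'rV[R]_n) : \bar R :=
  if x \in C then 0%E else +oo%E.

Definition frechet_quot {n : nat} (J : 'rV[R]_n -> \bar R) (xb v x : 'rV[R]_n)
  : \bar R :=
  ((J x - J xb - (dot v (x - xb))%:E) * ((enorm (x - xb))^-1)%:E)%E.

Definition pos_reals : set R := [set eps : R | 0 < eps].

Definition punct_ball {n : nat} (xb : 'rV[R]_n) (eps : R) : set 'rV[R]_n :=
  [set x | 0 < enorm (x - xb) < eps].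

Definition frechet_subdiff {n : nat} (J : 'rV[R]_n -> \bar R) (xb : 'rV[R]_n)
  : set 'rV[R]_n :=
  [set v | J xb \is a fin_num /\
    (0 <= ereal_sup [set ereal_inf
       (frechet_quot J xb v @` punct_ball xb eps)
      | eps in pos_reals])%E].

(* dist(0, S) in the extended reals (+oo if S is empty) *)
Definition dist0 {n : nat} (S : set 'rV[R]_n) : \bar R :=
  ereal_inf [set (enorm s)%:E | s in S].

Definition prox {m : nat} (mu : R) (g : 'rV[R]_m -> R) (zb : 'rV[R]_m) : 'rV[R]_m :=
  xget 0 [set z | forall w, g z + (2 * mu)^-1 * enorm (z - zb) ^+ 2
                           <= g w + (2 * mu)^-1 * enorm (w - zb) ^+ 2].

Definition moreau {m : nat} (mu : R) (g : 'rV[R]_m -> R) (zb : 'rV[R]_m) : R :=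
  g (prox mu g zb) + (2 * mu)^-1 * enorm (prox mu g zb - zb) ^+ 2.

Definition Mres {n : nat} (gamma : R) (J : 'rV[R]_n -> R) (C : set 'rV[R]_n)
  (xb : 'rV[R]_n) : \bar R :=
  dist0 [set gamma^-1 *: (xb - p) | p in
          [set p | exists2 v, frechet_subdiff (fun x => (J x)%:E) xb v
                             & proj C (xb - gamma *: v) p]].

End Defs.

(* Main.v *)
Require Import Defs.
From HB Require Import structures.
From mathcomp Require Import all_boot all_order all_algebra.
From mathcomp Require Import all_classical all_reals all_analysis.
From mathcomp Require Import ring lra.
Import Order.TTheory GRing.Theory Num.Theory.
Import numFieldNormedType.Exports.
Local Open Scope classical_set_scope.
Local Open Scope ring_scope.

(** Choose near-optimal residuals [s_k = (x_k - p_k) / gam_k], where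
    [p_k] is a nearest point of [C] to [x_k - gam_k v_k] and
    [v_k = DS(x_k)^* w_k] with [w_k = (S x_k - prox(S x_k)) / mu_k].  The [w_k]
    are bounded and are subgradients of [g], up to [eta/2 |.|^2], at points
    tending to [S xb]; along an ultrafilter everything converges, and the limit [v] of the
    [v_k] is a Frechet subgradient of [g o S] at [xb].  When [gb > 0] the closed
    graph of the projection concludes.  When [gb = 0], [s_k - v_k] is a proximal
    normal to [C] at [p_k] for a step size [gam_k] that may vanish.
    Single-valuedness of the projection allows the step to be doubled as long as
    it stays in a fixed neighbourhood of [xb], so the proximal inequality holds
    with a uniform constant and survives the limit. *)

(** * The Euclidean norm, limits and compactness *)

Lemma dotC {R : realType} {n : nat} (u v : 'rV[R]_n) : dot u v = dot v u.
Proof. by apply: eq_bigr => i _; rewrite mulrC. Qed.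

Lemma dotDl {R : realType} {n : nat} (u v w : 'rV[R]_n) :
  dot (u + v) w = dot u w + dot v w.
Proof. by rewrite -big_split; apply: eq_bigr => i _; rewrite mxE mulrDl. Qed.

Lemma dotDr {R : realType} {n : nat} (u v w : 'rV[R]_n) :
  dot w (u + v) = dot w u + dot w v.
Proof. by rewrite dotC dotDl !(dotC _ w). Qed.

Lemma dotZl {R : realType} {n : nat} (a : R) (u w : 'rV[R]_n) :
  dot (a *: u) w = a * dot u w.
Proof. by rewrite mulr_sumr; apply: eq_bigr => i _; rewrite mxE mulrA. Qed.

Lemma dotZr {R : realType} {n : nat} (a : R) (u w : 'rV[R]_n) :
  dot w (a *: u) = a * dot w u.
Proof. by rewrite dotC dotZl dotC. Qed.

Lemma dotNl {R : realType} {n : nat} (u w : 'rV[R]_n) : dot (- u) w = - dot u w.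
Proof. by rewrite -scaleN1r dotZl mulN1r. Qed.

Lemma dotNr {R : realType} {n : nat} (u w : 'rV[R]_n) : dot w (- u) = - dot w u.
Proof. by rewrite dotC dotNl dotC. Qed.

Lemma dot0l {R : realType} {n : nat} (w : 'rV[R]_n) : dot 0 w = 0.
Proof. by rewrite -(scale0r 0) dotZl mul0r. Qed.

Lemma dot0r {R : realType} {n : nat} (w : 'rV[R]_n) : dot w 0 = 0.
Proof. by rewrite dotC dot0l. Qed.

Definition dotE := (@dotDl, @dotDr, @dotZl, @dotZr, @dotNl, @dotNr).

Lemma dot_ge0 {R : realType} {n : nat} (u : 'rV[R]_n) : 0 <= dot u u.
Proof. by apply: sumr_ge0 => i _; rewrite -expr2 sqr_ge0. Qed.

Lemma enorm_ge0 {R : realType} {n : nat} (u : 'rV[R]_n) : 0 <= enorm u.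
Proof. exact: sqrtr_ge0. Qed.

Lemma enorm_sqr {R : realType} {n : nat} (u : 'rV[R]_n) : enorm u ^+ 2 = dot u u.
Proof. by rewrite sqr_sqrtr // dot_ge0. Qed.

Lemma enorm0 {R : realType} {n : nat} : enorm (0 : 'rV[R]_n) = 0.
Proof. by rewrite /enorm dot0l sqrtr0. Qed.

Lemma enormZ {R : realType} {n : nat} (a : R) (u : 'rV[R]_n) :
  enorm (a *: u) = `|a| * enorm u.
Proof. by rewrite /enorm !dotE mulrA -expr2 sqrtrM ?sqr_ge0// sqrtr_sqr. Qed.

Lemma enormN {R : realType} {n : nat} (u : 'rV[R]_n) : enorm (- u) = enorm u.
Proof. by rewrite -scaleN1r enormZ normrN1 mul1r. Qed.

Lemma enorm_distC {R : realType} {n : nat} (u v : 'rV[R]_n) :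
  enorm (u - v) = enorm (v - u).
Proof. by rewrite -enormN opprB. Qed.

Lemma enorm_eq0 {R : realType} {n : nat} (u : 'rV[R]_n) : enorm u <= 0 -> u = 0.
Proof.
move=> u0; have /eqP : dot u u = 0.
  rewrite -enorm_sqr (_ : enorm u = 0) ?expr0n//.
  by apply/eqP; rewrite eq_le u0 enorm_ge0.
rewrite psumr_eq0 => [/allP uu|i _]; last by rewrite -expr2 sqr_ge0.
apply/rowP => i; rewrite mxE.
by have := uu i (mem_index_enum i); rewrite mulf_eq0 orbb => /eqP.
Qed.

Lemma enorm_gt0 {R : realType} {n : nat} (u : 'rV[R]_n) : u <> 0 -> 0 < enorm u.
Proof.
by move=> u0; rewrite ltNge; apply/negP => /enorm_eq0.
Qed.

Lemma enorm_le_sqr {R : realType} {n : nat} (u : 'rV[R]_n) (a : R) :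
  0 <= a -> dot u u <= a ^+ 2 -> enorm u <= a.
Proof. by move=> a0; rewrite -enorm_sqr ler_sqr ?nnegrE ?enorm_ge0. Qed.

Lemma cauchy_schwarz {R : realType} {n : nat} (u v : 'rV[R]_n) :
  dot u v <= enorm u * enorm v.
Proof.
have [->|/enorm_gt0 u0] := pselect (u = 0); first by rewrite dot0l enorm0 mul0r.
have [->|/enorm_gt0 v0] := pselect (v = 0); first by rewrite dot0r enorm0 mulr0.
have := dot_ge0 (enorm v *: u - enorm u *: v).
rewrite !dotE (dotC v u) -!enorm_sqr => h.
have uv0 : 0 < enorm u * enorm v by rewrite mulr_gt0.
by rewrite -(ler_pM2l uv0); lra.
Qed.

Lemma cauchy_schwarz_norm {R : realType} {n : nat} (u v : 'rV[R]_n) :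
  `|dot u v| <= enorm u * enorm v.
Proof.
by rewrite ler_norml cauchy_schwarz andbT lerNl -dotNl -(enormN u) cauchy_schwarz.
Qed.

Lemma enormD {R : realType} {n : nat} (u v : 'rV[R]_n) :
  enorm (u + v) <= enorm u + enorm v.
Proof.
apply: enorm_le_sqr; first by rewrite addr_ge0 ?enorm_ge0.
rewrite !dotE (dotC v u) -!enorm_sqr.
by have := cauchy_schwarz u v; lra.
Qed.

Lemma enorm_triangle {R : realType} {n : nat} (w u v : 'rV[R]_n) :
  enorm (u - v) <= enorm (u - w) + enorm (w - v).
Proof. by rewrite -(subrKA w); exact: enormD. Qed.

(** The topology and derivatives of ['rV[R]_n] come from the supremum norm. This bound and
    [enorm_le_norm] make [enorm] equivalent to it, so results pass between the two. *)
Lemma norm_le_enorm {R : realType} {n : nat} (u : 'rV[R]_n) : `|u| <= enorm u.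
Proof.
rewrite /Num.norm/= mx_normrE; apply: bigmax_le => [|[i j] _ /=].
  exact: enorm_ge0.
rewrite ord1 -sqrtr_sqr ler_wsqrtr// /dot (bigD1 j)//= -expr2 lerDl.
by apply: sumr_ge0 => k _; rewrite -expr2 sqr_ge0.
Qed.

Lemma enorm_le_norm {R : realType} {n : nat} (u : 'rV[R]_n) :
  enorm u <= n%:R * `|u|.
Proof.
apply: enorm_le_sqr; first by rewrite mulr_ge0.
apply: (@le_trans _ _ (\sum_(i < n) `|u| ^+ 2)).
  apply: ler_sum => i _; rewrite -expr2 -real_normK ?num_real// ler_sqr ?nnegrE//.
  rewrite [leRHS]/Num.norm/= mx_normrE.
  exact: (le_bigmax _ (fun ij : 'I_1 * 'I_n => `|u ij.1 ij.2|) (ord0, i)).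
rewrite sumr_const card_ord -[leLHS]mulr_natl exprMn ler_wpM2r ?sqr_ge0//.
rewrite expr2 -natrM ler_nat; case: n {u} => // k.
by rewrite leq_pmulr.
Qed.

Lemma cvg_dot {R : realType} {n : nat} {T : Type} {F : set_system T}
    {FF : Filter F} (f h : T -> 'rV[R]_n) (a b : 'rV[R]_n) :
  f @ F --> a -> h @ F --> b -> dot (f x) (h x) @[x --> F] --> dot a b.
Proof.
move=> fa hb; apply: cvg_big => [|i _]; first exact: add_continuous.
by apply: cvgM; apply: (cvg_comp _ (fun u : 'rV[R]_n => u ord0 i));
  [exact: fa|exact: coord_continuous|exact: hb|exact: coord_continuous].
Qed.

Lemma cvg_enorm {R : realType} {n : nat} {T : Type} {F : set_system T}
    {FF : Filter F} (f : T -> 'rV[R]_n) (a : 'rV[R]_n) :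
  f @ F --> a -> enorm (f x) @[x --> F] --> enorm a.
Proof.
move=> fa; apply: (cvg_comp (fun x => dot (f x) (f x)) (@Num.sqrt R)).
  exact: (cvg_dot _ _ _ _ fa fa).
exact: sqrt_continuous.
Qed.

Lemma cvg_enorm_sub {R : realType} {n : nat} {T : Type} {F : set_system T}
    {FF : Filter F} (f h : T -> 'rV[R]_n) (a b : 'rV[R]_n) :
  f @ F --> a -> h @ F --> b -> enorm (f x - h x) @[x --> F] --> enorm (a - b).
Proof. by move=> fa hb; apply: cvg_enorm (cvgB fa hb). Qed.

Lemma enorm_cvg {R : realType} {n : nat} {T : Type} {F : set_system T}
    {FF : Filter F} (f : T -> 'rV[R]_n) (a : 'rV[R]_n) :
  enorm (f x - a) @[x --> F] --> 0 -> f @ F --> a.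
Proof.
move=> /cvgrPdist_lt fa; apply/cvgrPdist_lt => e /fa.
apply: filterS => x; rewrite sub0r normrN ger0_norm ?enorm_ge0// => h.
by apply: le_lt_trans h; rewrite distrC norm_le_enorm.
Qed.

Lemma compact_enorm_ball {R : realType} {n : nat} (a : 'rV[R]_n) (M : R) :
  compact [set z | enorm (z - a) <= M].
Proof.
apply: bounded_closed_compact; last first.
  have /continuous_closedP/(_ _ (@closed_le R M)) :
    continuous (fun z : 'rV[R]_n => enorm (z - a)); last exact.
  by move=> u; have := cvg_enorm_sub (F:=nbhs u) id (cst a) u a;
    apply => //; exact: cvg_cst.
exists (M + `|a|); split; first exact: num_real.
move=> r Mr z /= zM; apply: le_trans (ltW Mr).
by rewrite -(subrK a z) (le_trans (ler_normD _ _))// lerD2r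
  (le_trans (norm_le_enorm _)).
Qed.

Lemma fmap_ultra {T V : Type} (f : T -> V) (F : set_system T) :
  UltraFilter F -> UltraFilter (f @ F).
Proof.
move=> FU; have FP : ProperFilter F := ultra_proper.
split; first exact: fmap_proper_filter.
move=> G GP sFG; apply/seteqP; split => // A GA.
have [//|FnA] := in_ultra_setVsetC (f @^-1` A) FU.
have : G (~` A) by apply: sFG.
by move=> /(filterI GA); rewrite setICr => /filter_not_empty.
Qed.

(** Replaces the extraction of subsequences: one ultrafilter gives a limit to every bounded sequence
    at once. *)
Lemma ultra_bounded_cvg {R : realType} {n : nat} {T : Type} (U : set_system T)
    (f : T -> 'rV[R]_n) (M : R) :
  UltraFilter U -> (\forall k \near U, enorm (f k) <= M) ->
  exists a : 'rV[R]_n, f @ U --> a.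
Proof.
move=> UU UM.
have : [set A | compact A] [set z : 'rV[R]_n | enorm (z - 0) <= M].
  exact: compact_enorm_ball.
rewrite [X in X _ -> _](@compact_ultra 'rV[R]_n).
move=> /(_ (f @ U) (fmap_ultra f U UU)) [|a [_ fa]]; last by exists a.
by apply: filterS UM => k /=; rewrite subr0.
Qed.

(** Only points at or below the level [f a0] compete; they lie in a ball, whose intersection with
    [A] is compact. *)
Lemma closed_argmin {R : realType} {n : nat} (A : set 'rV[R]_n)
    (f : 'rV[R]_n -> R) (a0 : 'rV[R]_n) (M : R) :
  closed A -> A a0 -> continuous f ->
  (forall z, A z -> f z <= f a0 -> enorm (z - a0) <= M) ->
  exists2 c, A c & forall z, A z -> f c <= f z.
Proof.
move=> clA Aa0 cf bA.
pose B := A `&` [set z | enorm (z - a0) <= M].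
have ccB : compact B.
  rewrite /B setIC; apply: compact_closedI => //.
  exact: compact_enorm_ball.
have Ba0 : B a0 by split => //; exact: bA.
have [||c] := @EVT_min_rV R n f B _ ccB; first by exists a0.
  exact: continuous_subspaceT.
rewrite inE => -[Ac cM] minc; exists c => // z Az.
have [fz|/ltW fz] := leP (f z) (f a0).
  by apply: minc; rewrite inE; split => //; exact: bA.
by apply: le_trans fz; apply: minc; rewrite inE.
Qed.

Lemma cvg_row {R : realType} {n : nat} {T : Type} {F : set_system T}
    {FF : Filter F} (f : T -> 'rV[R]_n) (a : 'rV[R]_n) :
  (forall i, f x ord0 i @[x --> F] --> a ord0 i) -> f @ F --> a.
Proof.
move=> fa; rewrite (row_sum_delta a).
rewrite (_ : f = fun x => \sum_i f x ord0 i *: delta_mx ord0 i); last first.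
  by apply/funext => x; rewrite -row_sum_delta.
apply: cvg_big => [|i _]; first exact: add_continuous.
by apply: cvgZ; [exact: fa|exact: cvg_cst].
Qed.

(** * Frechet subgradients *)

(** The epsilon-delta form of the sup-inf condition. Off [C] the quotient is [+oo], so only points
    of [C] constrain [v]. *)
Lemma frechet_subdiff_indicatorP {R : realType} {n : nat} (C : set 'rV[R]_n)
    (F : 'rV[R]_n -> R) (xb v : 'rV[R]_n) : C xb ->
  frechet_subdiff (fun y => ((F y)%:E + indicator_fun C y)%E) xb v <->
  (forall e : R, 0 < e -> exists2 d, 0 < d & forall x, C x -> enorm (x - xb) < d ->
     dot v (x - xb) - e * enorm (x - xb) <= F x - F xb).
Proof.
move=> Cxb.
have ind x : C x -> ((F x)%:E + indicator_fun C x = (F x)%:E)%E.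
  by move=> Cx; rewrite /indicator_fun mem_set// adde0.
split=> [[_ v0] e e0|vP].
  have : ((- e)%:E < ereal_sup [set ereal_inf (frechet_quot
     (fun y => ((F y)%:E + indicator_fun C y)%E) xb v @` punct_ball xb eps)
      | eps in @pos_reals R])%E.
    by apply: lt_le_trans v0; rewrite lte_fin oppr_lt0.
  move=> /ereal_sup_gt[_ [d d0 <-] ed]; exists d => // x Cx xd.
  (* The punctured ball omits [xb], where both sides of the estimate vanish. *)
  have [|x0] := leP (enorm (x - xb)) 0.
    move=> /enorm_eq0 x0; rewrite x0 dot0r enorm0 mulr0 subr0.
    by move/eqP: x0; rewrite subr_eq0 => /eqP ->; rewrite subrr.
  have := lt_le_trans ed (@ereal_inf_lbound _ _ (frechet_quot
     (fun y => ((F y)%:E + indicator_fun C y)%E) xb v x) _).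
  have xin : (frechet_quot (fun y => ((F y)%:E + indicator_fun C y)%E) xb v
      @` punct_ball xb d) (frechet_quot
      (fun y => ((F y)%:E + indicator_fun C y)%E) xb v x).
    by exists x => //; rewrite /punct_ball /= x0.
  move=> /(_ xin); rewrite /frechet_quot !ind// -!EFinB -EFinM lte_fin.
  rewrite ltr_pdivlMr// => h.
  by move: h; set a := enorm _; set b := dot _ _; lra.
split; first by rewrite ind.
apply/lee_addgt0Pr => e /vP[d d0 dP].
rewrite -leeBlDr// sub0e -EFinN.
apply: (@le_trans _ _ (ereal_inf (frechet_quot
     (fun y => ((F y)%:E + indicator_fun C y)%E) xb v @` punct_ball xb d))).
  apply: le_ereal_inf_tmp => _ [x /= /andP[x0 xd] <-].
  rewrite /frechet_quot (ind xb)//.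
  have [Cx|nCx] := pselect (C x).
    rewrite ind// -!EFinB -EFinM lee_fin ler_pdivlMr//.
    by have := dP x Cx xd; lra.
  rewrite {1}/indicator_fun memNset//= addey// !addye//.
  by rewrite gt0_mulye ?leey// lte_fin invr_gt0.
by apply: ereal_sup_ubound; exists d.
Qed.

Lemma frechet_subdiffP {R : realType} {n : nat}
    (F : 'rV[R]_n -> R) (xb v : 'rV[R]_n) :
  frechet_subdiff (fun y => (F y)%:E) xb v <->
  (forall e : R, 0 < e -> exists2 d, 0 < d & forall x, enorm (x - xb) < d ->
     dot v (x - xb) - e * enorm (x - xb) <= F x - F xb).
Proof.
have -> : (fun y => (F y)%:E) = (fun y => ((F y)%:E + indicator_fun setT y)%E).
  by apply/funext => y; rewrite /indicator_fun in_setT adde0.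
rewrite frechet_subdiff_indicatorP//.
by split=> h e /h [d d0 dP]; exists d => // x; [exact: dP|move=> _; exact: dP].
Qed.

Lemma differentiable_enormP {R : realType} {n m : nat}
    (S : 'rV[R]_n -> 'rV[R]_m) (x : 'rV[R]_n) :
  differentiable S x -> forall e : R, 0 < e -> exists2 d, 0 < d &
    forall y, enorm (y - x) < d ->
      enorm (S y - S x - 'd S x (y - x)) <= e * enorm (y - x).
Proof.
move=> /diff_locally/eqaddoP dS e e0.
(* Dividing [e] by [m%:R + 1] absorbs the factor [m%:R] of [enorm_le_norm] and remains legitimate
   when [m = 0]. *)
have m1 : 0 < m%:R + 1 :> R by rewrite ltr_wpDl.
have /nbhs_normP[d /= d0 dP] := @dS (e / (m%:R + 1)) (divr_gt0 e0 m1).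
exists d => // y yd; have := dP (y - x); rewrite /ball_ /= sub0r normrN.
move=> /(_ (le_lt_trans (norm_le_enorm _) yd)).
rewrite !fctE /= subrK opprD addrA => h.
apply: le_trans (enorm_le_norm _) _.
apply: (@le_trans _ _ (m%:R * (e / (m%:R + 1) * enorm (y - x)))).
  rewrite ler_wpM2l// (le_trans h)// ler_wpM2l ?norm_le_enorm//.
  by rewrite divr_ge0// ltW.
rewrite mulrA ler_wpM2r ?enorm_ge0// mulrCA ger_pMr//.
by rewrite ler_pdivrMr// mul1r lerDl.
Qed.

Definition adjoint {R : realType} {n m : nat} (A : 'rV[R]_n -> 'rV[R]_m)
  (w : 'rV[R]_m) : 'rV[R]_n := \row_i dot w (A (delta_mx ord0 i)).

Lemma dot_adjoint {R : realType} {n m : nat} (A : {linear 'rV[R]_n -> 'rV[R]_m})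
    (w : 'rV[R]_m) (h : 'rV[R]_n) : dot (adjoint A w) h = dot w (A h).
Proof.
rewrite [in RHS](row_sum_delta h) linear_sum.
rewrite /dot; under [RHS]eq_bigr do rewrite summxE mulr_sumr.
rewrite exchange_big/=; apply: eq_bigr => i _; rewrite mxE /dot mulr_suml.
by apply: eq_bigr => j _; rewrite linearZ mxE/=; ring.
Qed.

(** Moving from [xb] in the direction [v - u] confronts the lower slope [v] with the upper slope
    [u]; the errors are too small to reconcile them unless [v = u]. *)
Lemma frechet_touching {R : realType} {n : nat} (F : 'rV[R]_n -> R)
    (xb v u : 'rV[R]_n) : frechet_subdiff (fun y => (F y)%:E) xb v ->
  (forall e : R, 0 < e -> exists2 d, 0 < d & forall x, enorm (x - xb) < d ->
     F x - F xb <= dot u (x - xb) + e * enorm (x - xb)) -> v = u.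
Proof.
move=> /frechet_subdiffP vP uP; apply/eqP; rewrite -subr_eq0; apply/eqP.
apply: contrapT => /enorm_gt0; set h := v - u => h0.
have e0 : 0 < enorm h / 4 by rewrite divr_gt0.
have [d1 d10 P1] := vP _ e0; have [d2 d20 P2] := uP _ e0.
(* The displacement [t *: h] has length half of [Num.min d1 d2], inside both balls. The two errors,
   each with factor [enorm h / 4], add up to only half of [t * enorm h ^+ 2]. *)
pose t := Num.min d1 d2 / (2 * enorm h).
have d0 : 0 < Num.min d1 d2 by rewrite lt_min d10.
have t0 : 0 < t by rewrite divr_gt0// mulr_gt0.
have nh : enorm (xb + t *: h - xb) = Num.min d1 d2 / 2.
  by rewrite addrC addKr enormZ gtr0_norm// /t; field; rewrite gt_eqF.
have lt : Num.min d1 d2 / 2 < Num.min d1 d2 by lra.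
have := P1 (xb + t *: h); have := P2 (xb + t *: h); rewrite nh.
move=> /(_ (lt_le_trans lt _)) Q2 /(_ (lt_le_trans lt _)) Q1.
have {Q1 Q2} := le_trans (Q1 _) (Q2 _).
rewrite !ge_min !lexx orbT => /(_ isT isT).
rewrite (addrC xb) addrK !dotZr => Q.
have : t * enorm h ^+ 2 <= Num.min d1 d2 * enorm h / 4.
  by rewrite enorm_sqr {1}/h dotDl dotNl; lra.
rewrite (_ : t * enorm h ^+ 2 = Num.min d1 d2 * enorm h / 2); last first.
  by rewrite /t; field; rewrite gt_eqF.
have := mulr_gt0 d0 h0; lra.
Qed.

(** * Proximal points and the Moreau envelope *)

(* Here and in the theorem, unqualified [lipschitz] is the library notion, for the
   supremum norm of ['rV[R]_n]. *)
Lemma lipschitz_enorm {R : realType} {n m : nat} (S : 'rV[R]_n -> 'rV[R]_m) :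
  lipschitz S -> Defs.lipschitz S.
Proof.
move=> [M [_ /(_ (`|M| + 1))]]; rewrite ltr_pwDr ?ler_norm// => /(_ isT) SM.
exists (m%:R * (`|M| + 1)) => x y; apply: (le_trans (enorm_le_norm _)).
rewrite -mulrA ler_wpM2l// (le_trans (SM (x, y) _))//=.
by rewrite ler_wpM2l ?norm_le_enorm// addr_ge0.
Qed.

Lemma lipschitz_real_cvg {R : realType} {n : nat} {T : Type} {F : set_system T}
    {FF : Filter F} (g : 'rV[R]_n -> R) (f : T -> 'rV[R]_n) (a : 'rV[R]_n) :
  lipschitz_real g -> f @ F --> a -> g (f x) @[x --> F] --> g a.
Proof.
move=> [L gL] fa.
have h0 : `|L| * enorm (f x - a) @[x --> F] --> 0.
  rewrite -(mulr0 `|L|) -(@enorm0 R n) -(subrr a).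
  by apply: cvgM; [exact: cvg_cst|apply: cvg_enorm_sub => //; exact: cvg_cst].
move/cvgrPdist_lt: h0 => h0; apply/cvgrPdist_lt => e /h0.
apply: filterS => x; rewrite sub0r normrN => h; apply: le_lt_trans h.
rewrite [leRHS]ger0_norm ?mulr_ge0 ?enorm_ge0// distrC (le_trans (gL _ _))//.
by rewrite ler_wpM2r ?enorm_ge0 ?ler_norm.
Qed.

Lemma lipschitz_cvg {R : realType} {n m : nat} {T : Type} {F : set_system T}
    {FF : Filter F} (S : 'rV[R]_n -> 'rV[R]_m) (f : T -> 'rV[R]_n)
    (a : 'rV[R]_n) :
  Defs.lipschitz S -> f @ F --> a -> S (f x) @[x --> F] --> S a.
Proof.
move=> [L SL] fa; apply: enorm_cvg.
have : `|L| * enorm (f x - a) @[x --> F] --> 0.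
  rewrite -(mulr0 `|L|) -(@enorm0 R n) -(subrr a).
  by apply: cvgM; [exact: cvg_cst|apply: cvg_enorm_sub => //; exact: cvg_cst].
apply: squeeze_cvgr (cvg_cst 0); apply: nearW => x; rewrite enorm_ge0/=.
by rewrite (le_trans (SL _ _))// ler_wpM2r ?enorm_ge0 ?ler_norm.
Qed.

Lemma lipschitz_real_ge0 {R : realType} {n : nat} (g : 'rV[R]_n -> R) :
  lipschitz_real g ->
  exists2 L : R, 0 <= L & forall x y, `|g x - g y| <= L * enorm (x - y).
Proof.
move=> [L gL]; exists `|L| => // x y; apply: (le_trans (gL x y)).
by rewrite ler_wpM2r ?enorm_ge0 ?ler_norm.
Qed.

(** The quadratic penalty is at most the Lipschitz variation [L * enorm (z - zb)]; divide by the
    distance. This serves both the existence of proximal points and the bound on the slopes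
    [(zb - p) / mu]. *)
Lemma sublevel_dist {R : realType} {m : nat} (g : 'rV[R]_m -> R) (L mu : R)
    (z zb : 'rV[R]_m) :
  (forall x y, `|g x - g y| <= L * enorm (x - y)) -> 0 <= L -> 0 < mu ->
  g z + (2 * mu)^-1 * enorm (z - zb) ^+ 2 <= g zb ->
  enorm (z - zb) <= 2 * mu * L.
Proof.
move=> gL L0 mu0 h; have mu20 : 0 < 2 * mu by rewrite mulr_gt0.
have {}h : (2 * mu)^-1 * enorm (z - zb) ^+ 2 <= L * enorm (z - zb).
  by have := gL z zb; rewrite ler_norml; lra.
have := enorm_ge0 (z - zb); rewrite le_eqVlt => /orP[/eqP <-|z0].
  by rewrite mulr_ge0// ltW.
move: h; rewrite expr2 mulrA ler_pM2r// -ler_pdivlMl ?invr_gt0//.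
by rewrite invrK.
Qed.

(** [prox] is an [xget] with default [0]; it has its defining property because [sublevel_dist]
    bounds the sublevel set and so a minimiser exists. *)
Lemma prox_min {R : realType} {m : nat} (g : 'rV[R]_m -> R) (mu : R)
    (zb w : 'rV[R]_m) : lipschitz_real g -> 0 < mu ->
  g (prox mu g zb) + (2 * mu)^-1 * enorm (prox mu g zb - zb) ^+ 2
  <= g w + (2 * mu)^-1 * enorm (w - zb) ^+ 2.
Proof.
move=> gL mu0; move: w; rewrite /prox.
set A := [set z | _]; suff : A !=set0.
  by case=> z Az; exact: (xgetPex _ (ex_intro _ z Az)).
have [L L0 gL'] := lipschitz_real_ge0 g gL.
have [||||c _ cP] := @closed_argmin R m setT
  (fun z => g z + (2 * mu)^-1 * enorm (z - zb) ^+ 2) zb (2 * mu * L).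
- exact: closedT.
- by [].
- move=> z; have cz : enorm (y - zb) @[y --> z] --> enorm (z - zb).
    by have := cvg_enorm_sub (F:=nbhs z) id (cst zb) z zb; apply => //;
      exact: cvg_cst.
  have gz : g y @[y --> z] --> g z.
    by have := lipschitz_real_cvg (F:=nbhs z) g id z gL; apply.
  exact: (cvgD gz (cvgM (cvg_cst _) (cvgM cz cz))).
- move=> z _; rewrite subrr enorm0 expr0n mulr0 addr0.
  exact: sublevel_dist.
by exists c => w; exact: cP.
Qed.

Lemma prox_dist {R : realType} {m : nat} (g : 'rV[R]_m -> R) (L mu : R)
    (zb : 'rV[R]_m) :
  (forall x y, `|g x - g y| <= L * enorm (x - y)) -> 0 <= L -> 0 < mu ->
  enorm (prox mu g zb - zb) <= 2 * mu * L.
Proof.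
move=> gL L0 mu0; apply: sublevel_dist => //.
have := prox_min g mu zb zb (ex_intro _ L gL) mu0.
by rewrite subrr enorm0 expr0n mulr0 addr0.
Qed.

(** Compare the minimiser [p] with [t *: z + (1 - t) *: p], bound [g] there by weak convexity,
    divide by [t] and let [t] tend to 0. The constant [eta / 2] does not depend on [mu], so the
    inequality survives [mu] tending to 0. *)
Lemma prox_subgradient {R : realType} {m : nat} (g : 'rV[R]_m -> R) (mu eta : R)
    (zb z p : 'rV[R]_m) : lipschitz_real g -> 0 <= eta -> weakly_convex eta g ->
  0 < mu -> p = prox mu g zb ->
  g p + dot (mu^-1 *: (zb - p)) (z - p) - eta / 2 * enorm (z - p) ^+ 2 <= g z.
Proof.
move=> gL eta0 gwc mu0 pE.
pose K := (2 * mu)^-1 * enorm (z - p) ^+ 2.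
have K0 : 0 <= K by rewrite mulr_ge0 ?sqr_ge0// invr_ge0 mulr_ge0// ltW.
rewrite -subr_le0; set G := (X in X <= 0).
have key t : 0 < t -> t <= 1 -> G <= t * K.
  move=> t0 t1; have := gwc z p t; rewrite (ltW t0) t1 => /(_ isT).
  have := prox_min g mu zb (t *: z + (1 - t) *: p) gL mu0; rewrite -pE.
  rewrite /G /K !enorm_sqr !dotE (dotC p z) (dotC zb p) (dotC zb z) => h1 h2.
  rewrite -(ler_pM2l t0).
  move: h1 h2; rewrite (_ : (2 * mu)^-1 = mu^-1 / 2); last first.
    by field; rewrite gt_eqF.
  have : 0 <= eta * (t ^+ 2 * dot (z - p) (z - p)).
    by rewrite mulr_ge0// mulr_ge0 ?sqr_ge0 ?dot_ge0.
  by rewrite !dotE (dotC p z); set a := g (t *: z + _); lra.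
(* If [G > 0], the admissible choice [t = G / (G + K)] in [key] would force [G + K <= K]. *)
rewrite leNgt; apply/negP => G0.
have GK : 0 < G + K by rewrite ltr_pwDl.
have := key (G / (G + K)); rewrite divr_gt0// ler_pdivrMr// mul1r lerDl K0.
move=> /(_ isT isT); rewrite mulrAC ler_pdivlMr// ler_pM2l// gerDr.
by rewrite leNgt G0.
Qed.

(** Half of [e] pays for the differentiability remainder, half for the square, which is at most
    [K * L ^+ 2 * enorm (y - x) ^+ 2]. It serves lower bounds on [g \o S] and upper bounds on the
    envelope alike. *)
Lemma chain_estimate {R : realType} {n m : nat} (S : 'rV[R]_n -> 'rV[R]_m)
    (x : 'rV[R]_n) (w : 'rV[R]_m) (K : R) :
  differentiable S x -> Defs.lipschitz S -> 0 <= K ->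
  forall e : R, 0 < e -> exists2 d, 0 < d & forall y, enorm (y - x) < d ->
    `|dot w (S y - S x) - dot (adjoint ('d S x) w) (y - x)|
      + K * enorm (S y - S x) ^+ 2 <= e * enorm (y - x).
Proof.
move=> dS [L SL] K0 e e0.
have e20 : 0 < e / 2 by rewrite divr_gt0.
have w1 : 0 < enorm w + 1 by rewrite ltr_wpDl ?enorm_ge0.
have [d1 d10 dP] := differentiable_enormP S x dS (e / 2 / (enorm w + 1))
  (divr_gt0 e20 w1).
have KL : 0 < K * L ^+ 2 + 1 by rewrite ltr_wpDl// mulr_ge0// sqr_ge0.
exists (Num.min d1 (e / 2 / (K * L ^+ 2 + 1))).
  by rewrite lt_min d10 !divr_gt0.
move=> y; rewrite lt_min => /andP[/dP h1 h2].
have y0 := enorm_ge0 (y - x).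
rewrite (splitr e) mulrDl lerD//.
  rewrite dot_adjoint -dotNr -dotDr (le_trans (cauchy_schwarz_norm _ _))//.
  apply: (@le_trans _ _ ((enorm w + 1) * (e / 2 / (enorm w + 1) * enorm (y - x)))).
    by rewrite ler_pM ?enorm_ge0// lerDl.
  by rewrite mulrA (mulrC (enorm w + 1)) divfK ?gt_eqF.
apply: (@le_trans _ _ (K * (L * enorm (y - x)) ^+ 2)).
  by rewrite ler_wpM2l// lerXn2r ?nnegrE ?enorm_ge0//
    (le_trans (enorm_ge0 _) (SL _ _)).
rewrite exprMn mulrA expr2 mulrA ler_wpM2r//.
move/ltW: h2; rewrite ler_pdivlMr//; lra.
Qed.

(** Pulling a quadratic minorant of [g] back through [S] costs only first-order negligible
    errors. *)
Lemma frechet_comp_weak {R : realType} {n m : nat} (S : 'rV[R]_n -> 'rV[R]_m)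
    (g : 'rV[R]_m -> R) (x : 'rV[R]_n) (w : 'rV[R]_m) (K : R) :
  differentiable S x -> Defs.lipschitz S -> 0 <= K ->
  (forall z, g (S x) + dot w (z - S x) - K * enorm (z - S x) ^+ 2 <= g z) ->
  frechet_subdiff (fun y => ((g \o S) y)%:E) x (adjoint ('d S x) w).
Proof.
move=> dS SL K0 gw; apply/frechet_subdiffP => e e0.
have [d d0 dP] := chain_estimate S x w K dS SL K0 e e0.
exists d => // y /dP h; have := gw (S y) => /=.
move: h; set A := dot w _; set B := dot (adjoint _ _) _.
have := ler_norm (B - A); rewrite distrC; lra.
Qed.

(* The Moreau envelope lies below [z |-> g p + |p - z|^2 / (2 mu)], with equality at
   the point whose proximal point is [p]. *)
Lemma frechet_moreau {R : realType} {n m : nat} (S : 'rV[R]_n -> 'rV[R]_m)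
    (g : 'rV[R]_m -> R) (mu : R) (x v : 'rV[R]_n) :
  differentiable S x -> Defs.lipschitz S -> lipschitz_real g -> 0 < mu ->
  frechet_subdiff (fun y => ((moreau mu g \o S) y)%:E) x v ->
  v = adjoint ('d S x) (mu^-1 *: (S x - prox mu g (S x))).
Proof.
move=> dS SL gL mu0 vx; apply: (frechet_touching _ _ _ _ vx) => e e0.
set p := prox mu g (S x); set w := mu^-1 *: _.
have K0 : 0 <= (2 * mu)^-1 by rewrite invr_ge0 mulr_ge0// ltW.
have [d d0 dP] := chain_estimate S x w _ dS SL K0 e e0.
exists d => // y /dP.
have := prox_min g mu (S y) p gL mu0; rewrite /= /moreau -/p.
set A := dot (adjoint _ _) _; set B := g (prox _ _ _) + _ => h1 h2.
have h3 := ler_norm (dot w (S y - S x) - A).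
have : (2 * mu)^-1 * enorm (p - S y) ^+ 2 = (2 * mu)^-1 * enorm (p - S x) ^+ 2
  + dot w (S y - S x) + (2 * mu)^-1 * enorm (S y - S x) ^+ 2.
  rewrite !enorm_sqr !dotE (dotC (S x) p) (dotC (S y) p) (dotC (S y) (S x)).
  by field; rewrite gt_eqF.
lra.
Qed.

(** Each coordinate pairs [w k] with the derivative at one basis vector, and the Lipschitz bound
    makes the latter converge. *)
Lemma cvg_adjoint {R : realType} {n m : nat} {T : Type} {F : set_system T}
    {FF : Filter F} (S : 'rV[R]_n -> 'rV[R]_m) (x : T -> 'rV[R]_n)
    (w : T -> 'rV[R]_m) (xb : 'rV[R]_n) (wb : 'rV[R]_m) :
  lipschitz_deriv S -> x @ F --> xb -> w @ F --> wb ->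
  adjoint ('d S (x k)) (w k) @[k --> F] --> adjoint ('d S xb) wb.
Proof.
move=> [L SL] xF wF.
pose e i : 'rV[R]_n := delta_mx ord0 i.
apply: (@cvg_row R n T F FF (fun k => adjoint ('d S (x k)) (w k))
  (adjoint ('d S xb) wb)) => i.
have adjE y v : adjoint ('d S y) v ord0 i = dot v ('d S y (e i)) by rewrite mxE.
rewrite (funext (fun k => adjE (x k) (w k))) adjE.
apply: (@cvg_dot R m T F FF w (fun k => 'd S (x k) (e i)) wb ('d S xb (e i)) wF).
apply: (@enorm_cvg R m T F FF (fun k => 'd S (x k) (e i)) ('d S xb (e i))).
have : `|L| * enorm (e i) * enorm (x k - xb) @[k --> F] --> 0.
  rewrite -(mulr0 (`|L| * enorm (e i))) -(@enorm0 R n) -(subrr xb).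
  by apply: cvgM; [exact: cvg_cst|apply: cvg_enorm_sub => //; exact: cvg_cst].
apply: squeeze_cvgr (cvg_cst 0); apply: nearW => k; rewrite enorm_ge0/=.
rewrite (le_trans (SL _ _ _))// mulrAC ler_wpM2r ?enorm_ge0// ler_wpM2r ?enorm_ge0//.
by rewrite ler_norm.
Qed.

(** * Projections and proximal normals *)

(* For [C q] and [t > 0] this says that [q] is a nearest point of [C] to [q + t u]. *)
Definition prox_normal {R : realType} {n : nat} (C : set 'rV[R]_n)
  (q u : 'rV[R]_n) (t : R) : Prop :=
  forall y, C y -> 2 * t * dot u (y - q) <= enorm (y - q) ^+ 2.

Lemma enorm_le_dot {R : realType} {n : nat} (u v : 'rV[R]_n) :
  (enorm u <= enorm v) = (dot u u <= dot v v).
Proof. by rewrite -!enorm_sqr ler_sqr ?nnegrE ?enorm_ge0. Qed.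

Lemma proj_prox_normal {R : realType} {n : nat} (C : set 'rV[R]_n)
    (q u : 'rV[R]_n) (t : R) : C q ->
  Defs.proj C (q + t *: u) q <-> prox_normal C q u t.
Proof.
have e y : (enorm (q + t *: u - q) <= enorm (q + t *: u - y)) =
    (2 * t * dot u (y - q) <= enorm (y - q) ^+ 2).
  rewrite enorm_le_dot enorm_sqr !dotE (dotC y q) (dotC u q) (dotC y u).
  by apply/idP/idP => ?; lra.
by move=> Cq; split=> [[_ h] y /h|h]; [rewrite e|split=> // y /h; rewrite e].
Qed.

Lemma prox_normal_le {R : realType} {n : nat} (C : set 'rV[R]_n)
    (q u : 'rV[R]_n) (s t : R) :
  0 <= s -> s <= t -> prox_normal C q u t -> prox_normal C q u s.
Proof.
move=> s0 st h y Cy; have [d0|/ltW d0] := leP (dot u (y - q)) 0.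
  by rewrite (@le_trans _ _ 0) ?sqr_ge0// mulr_ge0_le0// mulr_ge0.
by apply: le_trans (h y Cy); rewrite ler_wpM2r// ler_wpM2l.
Qed.

Lemma proj_exists {R : realType} {n : nat} (C : set 'rV[R]_n) (x : 'rV[R]_n) :
  closed C -> C !=set0 -> exists p, Defs.proj C x p.
Proof.
move=> clC [a Ca].
have [||||c Cc cP] := @closed_argmin R n C (fun z => enorm (x - z)) a
  (2 * enorm (x - a)) => //.
- move=> z; have := cvg_enorm_sub (F:=nbhs z) (cst x) id x z.
  by apply => //; exact: cvg_cst.
- move=> z _ zx; have := enorm_triangle x z a; rewrite (enorm_distC z x).
  by move=> /le_trans; apply; lra.
by exists c.
Qed.

Lemma proj_closed_graph {R : realType} {n : nat} (C : set 'rV[R]_n) {T : Type}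
    {F : set_system T} {FF : ProperFilter F} (y p : T -> 'rV[R]_n)
    (yb pb : 'rV[R]_n) : closed C -> y @ F --> yb -> p @ F --> pb ->
  (\forall k \near F, Defs.proj C (y k) (p k)) -> Defs.proj C yb pb.
Proof.
move=> clC yF pF yp; split.
  by apply: (closed_cvg _ clC _ _ pF); apply: filterS yp => k [].
move=> c Cc; rewrite -subr_ge0.
have h : enorm (y k - c) - enorm (y k - p k) @[k --> F] -->
    enorm (yb - c) - enorm (yb - pb).
  by apply: cvgB; apply: cvg_enorm_sub => //; exact: cvg_cst.
apply: (closed_cvg _ (@closed_ge R 0) _ _ h).
by apply: filterS yp => k [_ /(_ c Cc)] /=; rewrite subr_ge0.
Qed.

(** Expanding the square leaves [2 s <h, c> + s^2 |h|^2 <= 0]. The sign holds for every positive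
    [s], before any limit is taken. *)
Lemma dot_le0_of_enorm_le {R : realType} {n : nat} (c h : 'rV[R]_n) (s : R) :
  0 < s -> enorm (c + s *: h) <= enorm c -> dot h c <= 0.
Proof.
move=> s0; rewrite enorm_le_dot !dotE (dotC c h) -(pmulr_rle0 _ s0).
have : 0 <= s * (s * dot h h) by rewrite mulr_ge0 ?mulr_ge0 ?dot_ge0 ?ltW.
lra.
Qed.

(** The equality case of Cauchy-Schwarz: under these bounds the squared norm of the difference of
    the two sides is at most 0. *)
Lemma cauchy_schwarz_eq {R : realType} {n : nat} (a b : 'rV[R]_n) (e : R) :
  0 <= e -> enorm a <= e -> e * enorm b <= dot a b -> e *: b = enorm b *: a.
Proof.
move=> e0 ae ab.
apply/eqP; rewrite -subr_eq0; apply/eqP/enorm_eq0/enorm_le_sqr => //.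
rewrite !dotE (dotC b a) -!enorm_sqr expr0n/=.
have h1 : e * enorm b * (e * enorm b) <= e * enorm b * dot a b.
  by rewrite ler_wpM2l// mulr_ge0// enorm_ge0.
have h2 : enorm b ^+ 2 * enorm a ^+ 2 <= enorm b ^+ 2 * e ^+ 2.
  by rewrite ler_wpM2l ?sqr_ge0// ler_sqr ?nnegrE ?enorm_ge0.
lra.
Qed.

(* A maximiser [y] of the distance to [C] over the ball around [x := q + t u] of
   radius [t |u|] lies, by first-order optimality, on the ray from its nearest
   point through [x]; comparing distances shows that this nearest point is [q]. *)
Lemma prox_normal_double {R : realType} {n : nat} (C : set 'rV[R]_n)
    (q u : 'rV[R]_n) (t : R) : closed C -> C q -> 0 < t ->
  (forall y, enorm (y - (q + t *: u)) <= t * enorm u ->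
    exists p, Defs.proj C y = [set p]) ->
  prox_normal C q u t -> prox_normal C q u (2 * t).
Proof.
move=> clC Cq t0 uniqP qN.
have [->|/enorm_gt0 u0] := pselect (u = 0).
  by move=> y _; rewrite dot0l mulr0 sqr_ge0.
have {}qN := (proj_prox_normal C q u t Cq).2 qN.
apply/proj_prox_normal => //.
set x := q + t *: u in uniqP qN; set e := t * enorm u in uniqP.
have e0 : 0 < e by rewrite mulr_gt0.
have xq : enorm (x - q) = e by rewrite /x addrC addKr enormZ gtr0_norm.
have uniq y p p' : enorm (y - x) <= e -> Defs.proj C y p -> Defs.proj C y p' ->
    p = p'.
  by move=> /uniqP[r ->] /= -> ->.
pose P y := sval (cid (proj_exists C y clC (ex_intro _ q Cq))).
have PP y : Defs.proj C y (P y) by rewrite /P; case: cid.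
pose D y := enorm (y - P y).
have DL : lipschitz_real D.
  exists 1 => y z; have [_ /(_ (P z) (PP z).1) h1] := PP y.
  have [_ /(_ (P y) (PP y).1) h2] := PP z.
  have := enorm_triangle z y (P z); have := enorm_triangle y z (P y).
  by rewrite (enorm_distC z y) ler_norml /D; lra.
have cB := compact_enorm_ball x e.
have [||y] := @EVT_max_rV R n D [set z | enorm (z - x) <= e] _ cB.
- by exists x; rewrite /= subrr enorm0 ltW.
- apply: continuous_subspaceT => z.
  by have := lipschitz_real_cvg (F:=nbhs z) D id z DL; apply.
rewrite inE => yx ymax; rewrite /= in yx.
have Pin z : C z -> e <= enorm (x - z).
  by move=> Cz; rewrite -xq; exact: qN.2.
pose a := y - x; pose b := y - P y.
have be : e <= enorm b.
  apply: le_trans (Pin _ (PP x).1) _; apply: ymax.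
  by rewrite inE /= subrr enorm0 ltW.
have b0 : 0 < enorm b by exact: lt_le_trans be.
have ab : e * enorm b <= dot a b.
  rewrite leNgt; apply/negP => abe.
  (* [h] points from [y] to the point of the ball farthest in the direction [b]. Convexity keeps
     [z k] in the ball, and failure of the claim means [0 < dot h b]: moving along [h] should
     increase the distance. *)
  pose h := (e / enorm b) *: b - a.
  have hb : 0 < dot h b.
    by rewrite /h dotDl dotZl dotNl -enorm_sqr expr2 mulrA divfK ?gt_eqF// subr_gt0.
  pose s (k : nat) : R := k.+1%:R^-1.
  have s0 k : 0 < s k by rewrite invr_gt0.
  have s1 k : s k <= 1 by rewrite invf_le1// ler1n.
  pose z k := y + s k *: h.
  have zin k : enorm (z k - x) <= e.
    have -> : z k - x = (1 - s k) *: a + s k *: ((e / enorm b) *: b).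
      by apply/rowP => i; rewrite /z /h /a !mxE; ring.
    apply: (le_trans (enormD _ _)); rewrite !enormZ.
    rewrite (ger0_norm (ltW (s0 k))) (ger0_norm (ltW (divr_gt0 e0 b0))).
    rewrite (@ger0_norm _ (1 - s k)) ?subr_ge0//.
    rewrite divfK ?gt_eqF//.
    have : (1 - s k) * enorm a <= (1 - s k) * e by rewrite ler_wpM2l ?subr_ge0.
    by lra.
  (* Maximality gives [D (z k) <= D y], and [D y] is at most the distance from [y] to [P (z k)]. *)
  have hz k : dot h (y - P (z k)) <= 0.
    have := ymax (z k); rewrite inE => /(_ (zin k)) h1.
    have := le_trans h1 ((PP y).2 (P (z k)) (PP _).1).
    rewrite /D (_ : z k - P (z k) = (y - P (z k)) + s k *: h); last first.
      by rewrite {1}/z addrAC.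
    exact: dot_le0_of_enorm_le.
  have [U [UU sU]] := ultraFilterLemma (@eventually_filter).
  have zU : z @ U --> y.
    apply: cvg_trans (_ : z @ \oo --> y); first exact: cvg_app.
    rewrite -[X in _ --> X]addr0 -(scale0r h); apply: cvgD; first exact: cvg_cst.
    by apply: cvgZr_tmp; exact: cvg_harmonic.
  have [|pb pU] := ultra_bounded_cvg U (P \o z) (enorm y + enorm h + D y) UU.
    apply: nearW => k /=.
    have := ymax (z k); rewrite inE => /(_ (zin k)) h1.
    have := enorm_triangle (z k) (P (z k)) 0; rewrite !subr0 enorm_distC.
    have := enormD y (s k *: h); rewrite -/(z k) enormZ gtr0_norm//.
    have : s k * enorm h <= 1 * enorm h by rewrite ler_wpM2r ?enorm_ge0.
    by move: h1; rewrite /D; lra.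
  (* The nearest points of [z k] tend to a nearest point of [y], which by uniqueness is [P y]; so
     [dot h b <= 0], a contradiction. *)
  have pP : Defs.proj C y pb.
    by apply: (proj_closed_graph C z (P \o z) y pb clC zU pU);
      apply: nearW => k; exact: PP.
  have {}pP := uniq _ _ _ yx pP (PP y).
  have : dot h (y - pb) <= 0.
    have hc : dot h (y - P (z k)) @[k --> U] --> dot h (y - pb).
      by apply: cvg_dot; [exact: cvg_cst|apply: cvgB => //; exact: cvg_cst].
    by apply: (closed_cvg _ (@closed_le R 0) _ _ hc); exact: nearW.
  by rewrite pP -/b leNgt hb.
have eb : e *: b = enorm b *: a by apply: cauchy_schwarz_eq => //; exact: ltW.
have xP : enorm (x - P y) = enorm b - e.
  have : enorm b * enorm (x - P y) = enorm b * (enorm b - e).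
    rewrite -{1}(ger0_norm (enorm_ge0 b)) -enormZ.
    have -> : x - P y = b - a.
      by rewrite /a /b opprB [RHS]addrC subrKA.
    rewrite scalerBr -eb -scalerBl enormZ ger0_norm ?subr_ge0//.
    by rewrite mulrC.
  by move/(mulfI (lt0r_neq0 b0)).
(* At least [2 * e] because [P y] is at distance at least [e] from [x]; at most [2 * e] because [q]
   is within [2 * e] of [y]. *)
have b2 : enorm b = 2 * e.
  have := Pin _ (PP y).1; have := (PP y).2 _ Cq; have := enorm_triangle x y q.
  by rewrite xq xP -/b => *; apply/eqP; rewrite eq_le; apply/andP; split; lra.
have qE : P y = q.
  apply: (uniq x) => //; first by rewrite subrr enorm0 ltW.
  split; first exact: (PP y).1.
  by move=> z Cz; rewrite xP b2 (_ : 2 * e - e = e) ?Pin//; ring.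
have yE : y = q + (2 * t) *: u.
  have : b = 2 *: a.
    have /(scalerI (lt0r_neq0 e0)) : e *: b = e *: (2 *: a); last by [].
    by rewrite eb b2 scalerA mulrC.
  rewrite /b /a qE /x => /eqP; rewrite -subr_eq0 => /eqP h.
  apply/eqP; rewrite -subr_eq0 -oppr_eq0 -h; apply/eqP/rowP => i; rewrite !mxE.
  by ring.
by rewrite -yE -qE.
Qed.

(** Iterates the doubling with the step capped at [r]. For [s <= r] the ball around [q + s u] of
    radius [s |u|] stays within [2 r |u|] of [q], where projections are unique. *)
Lemma prox_normal_extend {R : realType} {n : nat} (C : set 'rV[R]_n)
    (q u : 'rV[R]_n) (t r : R) : closed C -> C q -> 0 < t -> 0 < r ->
  (forall y, enorm (y - q) <= 2 * r * enorm u ->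
    exists p, Defs.proj C y = [set p]) ->
  prox_normal C q u t -> prox_normal C q u r.
Proof.
move=> clC Cq t0 r0 uniqP qN.
have step k : prox_normal C q u (Num.min (t * 2 ^+ k) r).
  elim: k => [|k IH].
    by apply: prox_normal_le qN;
      rewrite ?le_min ?ge_min expr0 mulr1 ?(ltW t0) ?(ltW r0) ?lexx.
  set s := Num.min _ _ in IH.
  have s0 : 0 < s by rewrite lt_min r0 mulr_gt0 ?exprn_gt0.
  apply: (@prox_normal_le _ _ _ _ _ _ (2 * s)).
  - by rewrite le_min (ltW r0) mulr_ge0 ?exprn_ge0// ltW.
  - rewrite /s minr_pMr// mulrCA -exprS le_min !ge_min lexx/=.
    by apply/orP; right; lra.
  apply: prox_normal_double => // y yx; apply: uniqP.
  apply: (le_trans (enorm_triangle (q + s *: u) _ _)).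
  rewrite (addrC q) addrK enormZ gtr0_norm//.
  have : s * enorm u <= r * enorm u.
    by rewrite ler_wpM2r ?enorm_ge0// ge_min lexx orbT.
  by rewrite (addrC _ q); lra.
pose k := Num.bound (r / t); have := step k.
rewrite (min_idPr _)//; apply: ltW; rewrite mulrC -ltr_pdivrMr//.
apply: lt_trans (archi_boundP (divr_ge0 (ltW r0) (ltW t0))) _.
by rewrite -natrX ltr_nat ltn_expl.
Qed.

(** The steps [c k] may tend to 0, so each is first extended to a common [r]; the inequality at step
    [r] then passes to the limit. *)
Lemma prox_regular_normal_limit {R : realType} {n : nat} (C : set 'rV[R]_n)
    {T : Type} {F : set_system T} {FF : ProperFilter F} (q u : T -> 'rV[R]_n)
    (c : T -> R) (qb ub : 'rV[R]_n) :
  closed C -> prox_regular C -> C qb -> q @ F --> qb -> u @ F --> ub ->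
  (\forall k \near F, [/\ C (q k), 0 < c k & prox_normal C (q k) (u k) (c k)]) ->
  exists2 r, 0 < r & prox_normal C qb ub r.
Proof.
move=> clC [V [oV [CV VP]]] Cqb qF uF h.
have /nbhs_normP[d /= d0 dP] : nbhs qb V.
  by apply: open_nbhs_nbhs; split => //; exact: CV.
have u1 : 0 < enorm ub + 1 by rewrite ltr_wpDl ?enorm_ge0.
(* Eventually [2 * r * enorm (u k) <= d / 2] and [q k] is within [d / 2] of [qb], so the ball
   required by [prox_normal_extend] lies in [V]. *)
pose r := d / (4 * (enorm ub + 1)).
have r0 : 0 < r by rewrite divr_gt0// mulr_gt0.
exists r => // y Cy; rewrite -subr_ge0.
have qF' : enorm (q k - qb) @[k --> F] --> 0.
  by rewrite -(@enorm0 R n) -(subrr qb); apply: cvg_enorm_sub => //; exact: cvg_cst.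
have yq : enorm (y - q k) @[k --> F] --> enorm (y - qb).
  by apply: cvg_enorm_sub => //; exact: cvg_cst.
have lim : enorm (y - q k) * enorm (y - q k)
      - 2 * r * dot (u k) (y - q k) @[k --> F] -->
    enorm (y - qb) * enorm (y - qb) - 2 * r * dot ub (y - qb).
  apply: cvgB; first exact: (cvgM yq yq).
  apply: cvgM; first exact: cvg_cst.
  by apply: cvg_dot => //; apply: cvgB => //; exact: cvg_cst.
rewrite expr2; apply: (closed_cvg _ (@closed_ge R 0) _ _ lim).
have q1 : \forall k \near F, enorm (q k - qb) < d / 2.
  by apply: (cvgr_lt _ qF'); rewrite divr_gt0.
have u2 : \forall k \near F, enorm (u k) < enorm ub + 1.
  by apply: (cvgr_lt _ (cvg_enorm _ _ uF)); rewrite ltrDl.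
near=> k.
have [Cq c0 N] : [/\ C (q k), 0 < c k & prox_normal C (q k) (u k) (c k)] by near: k.
have qk : enorm (q k - qb) < d / 2 by near: k.
have uk : enorm (u k) < enorm ub + 1 by near: k.
rewrite /= subr_ge0 -expr2.
apply: (prox_normal_extend C (q k) (u k) (c k) r) => // z zq.
apply: VP; apply: dP => /=; rewrite distrC; apply: le_lt_trans (norm_le_enorm _) _.
apply: le_lt_trans (enorm_triangle (q k) _ _) _.
have : 2 * r * enorm (u k) <= 2 * r * (enorm ub + 1).
  by apply: ler_wpM2l (ltW uk); apply: mulr_ge0 => //; exact: ltW.
have : 2 * r * (enorm ub + 1) = d / 2 by rewrite /r; field; rewrite gt_eqF.
by lra.
Unshelve. all: by end_near. Qed.

(** On [C] the normal contributes at most [|y - xb|^2 / (2 r)], which is below [e / 2 * |y - xb|]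
    once [|y - xb| < r e]. *)
Lemma frechet_add_normal {R : realType} {n : nat} (C : set 'rV[R]_n)
    (F : 'rV[R]_n -> R) (xb v u : 'rV[R]_n) (r : R) :
  C xb -> 0 < r -> frechet_subdiff (fun y => (F y)%:E) xb v ->
  prox_normal C xb u r ->
  frechet_subdiff (fun y => ((F y)%:E + indicator_fun C y)%E) xb (v + u).
Proof.
move=> Cxb r0 /frechet_subdiffP vP uN.
apply/frechet_subdiff_indicatorP => // e e0.
have [d d0 dP] := vP _ (divr_gt0 e0 (ltr0Sn R 1)).
exists (Num.min d (r * e)); first by rewrite lt_min d0 mulr_gt0.
move=> y Cy; rewrite lt_min => /andP[/dP h1 /ltW h2].
have := uN y Cy; rewrite dotDl.
have : enorm (y - xb) * enorm (y - xb) <= r * e * enorm (y - xb).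
  by rewrite ler_wpM2r ?enorm_ge0.
rewrite expr2 => h3 h4.
have : dot u (y - xb) <= e / 2 * enorm (y - xb).
  rewrite -(@ler_pM2l _ (2 * r)) ?mulr_gt0//.
  by apply: (le_trans h4); apply: (le_trans h3); lra.
by lra.
Qed.

(** * Passage to the limit *)

Lemma limn_einfE {R : realType} (u : nat -> \bar R) :
  limn_einf u = ereal_sup (range (einfs u)).
Proof.
by rewrite limn_einf_lim; apply/cvg_lim => //; exact: cvg_einfs_sup.
Qed.

Lemma limn_einf_ge0 {R : realType} (u : nat -> \bar R) :
  (forall k, 0 <= u k)%E -> (0 <= limn_einf u)%E.
Proof.
move=> u0; rewrite limn_einfE; apply: (@le_trans _ _ (einfs u 0)).
  by apply: le_ereal_inf_tmp => _ [k _ <-].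
by apply: ereal_sup_ubound; exists 0%N.
Qed.

(** Plays the role of a subsequence realising the lower limit. The sets [B (N, c)] with [l < c] are
    nonempty, since every tail infimum is at most [l], and an ultrafilter refines the filter they
    generate. *)
Lemma limn_einf_ultra {R : realType} (u : nat -> \bar R) (l : R) :
  limn_einf u = l%:E -> exists U : set_system nat,
    [/\ UltraFilter U, \oo `<=` U &
        forall c : R, l < c -> \forall k \near U, (u k < c%:E)%E].
Proof.
move=> ul.
pose B (i : nat * R) := [set k | (i.1 <= k)%N /\ (u k < i.2%:E)%E].
have FP : ProperFilter (filter_from [set i : nat * R | l < i.2] B).
  apply: filter_from_proper; last first.
    move=> [N c] /= lc; have : (einfs u N < c%:E)%E.
      apply: (@le_lt_trans _ _ l%:E); last by rewrite lte_fin.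
      by rewrite -ul limn_einfE; apply: ereal_sup_ubound; exists N.
    by move=> /ereal_inf_lt[_ [k Nk <-] kc]; exists k.
  apply: filter_from_filter; first by exists (0%N, l + 1); rewrite /= ltrDl.
  move=> [N c] [N' c'] /= lc lc'; exists (maxn N N', Num.min c c').
    by rewrite /= lt_min lc lc'.
  move=> k [/=]; rewrite geq_max => /andP[Nk Nk'].
  rewrite EFin_min lt_min => /andP[kc kc'].
  by split; split.
have [U [UU sU]] := ultraFilterLemma FP.
exists U; split => //.
  move=> A [N _ NA]; apply: sU; exists (N, l + 1); first by rewrite /= ltrDl.
  by move=> k [Nk _]; exact: NA.
by move=> c lc; apply: sU; exists (0%N, c) => // k [].
Qed.

Lemma dist0_ge0 {R : realType} {n : nat} (A : set 'rV[R]_n) : (0 <= dist0 A)%E.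
Proof. by apply: le_ereal_inf_tmp => _ [s _ <-]; rewrite lee_fin enorm_ge0. Qed.

Lemma Mres_approx {R : realType} {n : nat} (gam e : R) (J : 'rV[R]_n -> R)
    (C : set 'rV[R]_n) (x : 'rV[R]_n) :
  0 < e -> (Mres gam J C x < +oo)%E ->
  exists p v, [/\ frechet_subdiff (fun y => (J y)%:E) x v,
    Defs.proj C (x - gam *: v) p &
    ((enorm (gam^-1 *: (x - p)))%:E < Mres gam J C x + e%:E)%E].
Proof.
move=> e0 Moo.
have Mfin : Mres gam J C x \is a fin_num.
  by rewrite ge0_fin_numE// dist0_ge0.
have : (Mres gam J C x < Mres gam J C x + e%:E)%E.
  by rewrite lteDl// lte_fin.
by move=> /ereal_inf_lt[_ [_ [p [v vx pv] <-] <-] h]; exists p, v.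
Qed.

(** Both assertions of the theorem are read off this one limit. The subgradient [v] is returned with
    [s] because, when [0 < gb], the second assertion needs the normal [- v]. *)
Lemma residual_limit {R : realType} {n m : nat}
    (S : 'rV[R]_n -> 'rV[R]_m) (g : 'rV[R]_m -> R) (eta : R)
    (C : set 'rV[R]_n) (x : nat -> 'rV[R]_n) (xb : 'rV[R]_n)
    (gam : nat -> R) (gb : R) (mu : nat -> R) (l : R) :
  (forall y, differentiable S y) -> Defs.lipschitz S -> lipschitz_deriv S ->
  0 < eta -> lipschitz_real g -> weakly_convex eta g ->
  closed C -> prox_regular C -> C xb -> x @ \oo --> xb ->
  (forall k, 0 < gam k) -> 0 <= gb -> gam @ \oo --> gb ->
  (forall k, 0 < mu k) -> mu @ \oo --> 0 ->
  limn_einf (fun k => Mres (gam k) (moreau (mu k) g \o S) C (x k)) = l%:E ->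
  exists s v, [/\ enorm s <= l,
    frechet_subdiff (fun y => ((g \o S) y)%:E) xb v &
    if 0 < gb then Defs.proj C (xb - gb *: v) (xb - gb *: s)
    else frechet_subdiff (fun y => (((g \o S) y)%:E + indicator_fun C y)%E) xb s].
Proof.
move=> dS SL dSL eta0 gL gwc clC prC Cxb xF gam0 gb0 gamF mu0 muF.
set M := fun k => Mres _ _ _ _ => Ml.
have [U [UU sU Uc]] := limn_einf_ultra M l Ml.
have cvgU (V : topologicalType) (f : nat -> V) (a : V) :
    f @ \oo --> a -> f @ U --> a.
  by move=> fa; apply: cvg_trans fa; exact: cvg_app.
have {}xF : x @ U --> xb by exact: cvgU.
have {}gamF : gam @ U --> gb by exact: cvgU.
have {}muF : mu @ U --> 0 by exact: cvgU.
(* [mu k] doubles as the tolerance of near-optimality: it is positive and tends to 0. Where [M k] is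
   infinite the pair is arbitrary; along [U] this eventually does not occur. *)
pose good k (pv : 'rV[R]_n * 'rV[R]_n) :=
  [/\ frechet_subdiff (fun y => ((moreau (mu k) g \o S) y)%:E) (x k) pv.2,
    Defs.proj C (x k - gam k *: pv.2) pv.1 &
    ((enorm ((gam k)^-1 *: (x k - pv.1)))%:E < M k + (mu k)%:E)%E].
have /choice[pv pvP] : forall k, exists pv, (M k < +oo)%E -> good k pv.
  move=> k; have [Moo|] := pselect (M k < +oo)%E; last by exists (0, 0).
  have [p [v h]] := Mres_approx (gam k) (mu k) _ _ _ (mu0 k) Moo.
  by exists (p, v).
pose p k := (pv k).1; pose s k := (gam k)^-1 *: (x k - p k).
pose pz k := prox (mu k) g (S (x k)); pose w k := (mu k)^-1 *: (S (x k) - pz k).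
pose v k := adjoint ('d S (x k)) (w k).
have pE k : p k = x k - gam k *: s k.
  by rewrite /s scalerA divff ?gt_eqF// scale1r subKr.
have pzE k : pz k = S (x k) - mu k *: w k.
  by rewrite /w scalerA divff ?gt_eqF// scale1r subKr.
have Ugood : \forall k \near U, Defs.proj C (x k - gam k *: v k) (p k).
  have l1 : l < l + 1 by rewrite ltrDl.
  apply: filterS (Uc _ l1) => k Mk.
  have [vk pk _] := pvP k (lt_trans Mk (ltry _)).
  by rewrite /v -(frechet_moreau S g (mu k) (x k) (pv k).2).
have Us c : l < c -> \forall k \near U, enorm (s k) <= c + mu k.
  move=> /Uc; apply: filterS => k Mk.
  have [_ _ sk] := pvP k (lt_trans Mk (ltry _)).
  by rewrite -lee_fin EFinD (le_trans (ltW sk))// leeD2r// ltW.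
have [sb sF] : exists sb : 'rV[R]_n, s @ U --> sb.
  apply: (ultra_bounded_cvg U s (l + 1 + 1) UU).
  have m1 : \forall k \near U, mu k < 1 by exact: (cvgr_lt _ muF).
  have l1 : l < l + 1 by rewrite ltrDl.
  apply: filterS2 (Us _ l1) m1 => k h1 h2.
  by apply: le_trans h1 _; rewrite lerD2l ltW.
have [L L0 gL'] := lipschitz_real_ge0 g gL.
(* The displacement of the proximal point is at most [2 * mu k * L], so dividing by [mu k] leaves
   the uniform bound [2 * L]. *)
have [wb wF] : exists wb : 'rV[R]_m, w @ U --> wb.
  apply: (ultra_bounded_cvg U w (2 * L) UU); apply: nearW => k.
  rewrite /w enormZ gtr0_norm ?invr_gt0// enorm_distC.
  rewrite ler_pdivrMl// mulrCA mulrA.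
  exact: prox_dist.
have pzF : pz @ U --> S xb.
  rewrite (funext pzE) -[X in _ --> X]subr0 -(scale0r wb).
  apply: cvgB; last exact: cvgZ.
  exact: lipschitz_cvg.
have sbl : enorm sb <= l.
  apply/ler_addgt0Pr => e e0; have le : l < l + e by rewrite ltrDl.
  rewrite -[leRHS]addr0.
  have h1 : l + e + mu k @[k --> U] --> l + e + 0.
    by apply: cvgD => //; exact: cvg_cst.
  exact: (ler_cvg_to (cvg_enorm _ _ sF) h1 (Us _ le)).
have vF : v @ U --> adjoint ('d S xb) wb by exact: cvg_adjoint.
have vsub : frechet_subdiff (fun y => ((g \o S) y)%:E) xb (adjoint ('d S xb) wb).
  apply: (frechet_comp_weak S g xb wb (eta / 2)) => //.
    by rewrite divr_ge0// ltW.
  move=> z; rewrite expr2.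
  have zF : z - pz k @[k --> U] --> z - S xb by apply: cvgB => //; exact: cvg_cst.
  have nF : enorm (z - pz k) @[k --> U] --> enorm (z - S xb).
    exact: cvg_enorm.
  have n2F : eta / 2 * (enorm (z - pz k) * enorm (z - pz k)) @[k --> U] -->
      eta / 2 * (enorm (z - S xb) * enorm (z - S xb)).
    exact: (cvgM (cvg_cst _) (cvgM nF nF)).
  have gF : g (pz k) @[k --> U] --> g (S xb) by exact: lipschitz_real_cvg.
  have wzF : dot (w k) (z - pz k) @[k --> U] --> dot wb (z - S xb).
    exact: cvg_dot.
  have lim : g (pz k) + dot (w k) (z - pz k)
      - eta / 2 * (enorm (z - pz k) * enorm (z - pz k)) @[k --> U] -->
    g (S xb) + dot wb (z - S xb)
      - eta / 2 * (enorm (z - S xb) * enorm (z - S xb)).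
    exact: (cvgB (cvgD gF wzF) n2F).
  apply: (closed_cvg _ (@closed_le R (g z)) _ _ lim).
  apply: nearW => k /=; rewrite -expr2.
  by apply: (prox_subgradient g (mu k) eta (S (x k))) => //; exact: ltW.
have pF : p @ U --> xb - gb *: sb.
  by rewrite (funext pE); apply: cvgB => //; exact: cvgZ.
exists sb, (adjoint ('d S xb) wb); split => //.
have [gbp|gbn] := ltP 0 gb.
  apply: (proj_closed_graph (F:=U) C (fun k => x k - gam k *: v k) p) => //.
  exact: (cvgB xF (cvgZ gamF vF)).
have gbE : gb = 0 by apply/eqP; rewrite eq_le gbn gb0.
rewrite gbE scale0r subr0 in pF.
(* The projected point [x k - gam k *: v k] equals [p k + gam k *: (s k - v k)], so [s k - v k] is a
   proximal normal at [p k] with step [gam k]. *)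
have [r r0 N] : exists2 r, 0 < r & prox_normal C xb (sb - adjoint ('d S xb) wb) r.
  apply: (prox_regular_normal_limit (F:=U) C p (fun k => s k - v k) gam) => //.
    exact: (cvgB sF vF).
  apply: filterS Ugood => k pk; have Cpk := pk.1; split => //.
  apply/proj_prox_normal => //.
  by rewrite {1}pE scalerBr addrA subrK.
by rewrite -(subrKC (adjoint ('d S xb) wb) sb); exact: frechet_add_normal N.
Qed.

Theorem theorem1 (R : realType) (n m : nat)
  (S : 'rV[R]_n -> 'rV[R]_m) (g : 'rV[R]_m -> R) (eta : R)
  (C : set 'rV[R]_n)
  (x : nat -> 'rV[R]_n) (xb : 'rV[R]_n)
  (gam : nat -> R) (gb : R) (mu : nat -> R) :
  (forall y, differentiable S y) ->
  lipschitz S -> lipschitz_deriv S ->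
  0 < eta -> lipschitz_real g -> weakly_convex eta g ->
  C !=set0 -> closed C -> prox_regular C ->
  (exists2 x0, C x0 & forall y, C y -> g (S x0) <= g (S y)) ->
  (forall k, C (x k)) -> C xb -> x @ \oo --> xb ->
  (forall k, 0 < gam k) -> 0 <= gb -> gam @ \oo --> gb ->
  (forall k, 0 < mu k <= (2 * eta)^-1) ->
  (forall k, mu k.+1 <= mu k) -> mu @ \oo --> 0 ->
  let F := g \o S in
  let Fn := fun k => moreau (mu k) g \o S in
  let lhs := limn_einf (fun k => Mres (gam k) (Fn k) C (x k)) in
  (lhs >= (if (0 < gb)%R then Mres gb F C xb
           else dist0 (frechet_subdiff (fun y => ((F y)%:E + indicator_fun C y)%E) xb)))%E
  /\ (lhs = 0%E -> frechet_subdiff (fun y => ((F y)%:E + indicator_fun C y)%E) xb 0).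
Proof.
move=> dS SL dSL eta0 gL gwc _ clC prC _ _ Cxb xF gam0 gb0 gamF muP _ muF F Fn lhs.
have mu0 k : 0 < mu k by case/andP: (muP k).
have lim l : lhs = l%:E -> _ := fun lhsE => residual_limit S g eta C x xb gam gb
  mu l dS (lipschitz_enorm S SL) dSL eta0 gL gwc clC prC Cxb xF gam0 gb0 gamF
  mu0 muF lhsE.
have lhs0 : (0 <= lhs)%E by apply: limn_einf_ge0 => k; exact: dist0_ge0.
split.
  (* Nonnegativity excludes [-oo], and [+oo] dominates any right-hand side. *)
  move: lim lhs0; case: lhs => [l lim _|_ _|//]; last by rewrite leey.
  have [s [v [sl vF sP]]] := lim l erefl.
  apply: (@le_trans _ _ (enorm s)%:E); last by rewrite lee_fin.
  move: sP; case: ifPn => [gbp sP|_ sP]; apply: ereal_inf_lbound; exists s => //.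
  exists (xb - gb *: s); first by exists v.
  by rewrite subKr scalerA mulVf ?gt_eqF// scale1r.
(* Here [s = 0]. If [0 < gb], [xb] is a nearest point to [xb - gb *: v], so [- v] is a proximal
   normal at [xb] and [v + (- v) = 0] is the wanted subgradient. *)
move=> /lim[s [v [/enorm_eq0 -> vF]]].
have [gbp|//] := ltP 0 gb.
rewrite scaler0 subr0 -scalerN => /proj_prox_normal N.
by rewrite -(subrr v); exact: frechet_add_normal (N Cxb).
Qed.
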